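(* For all $x\in(0,1)$, $$\mathbb{P}_x\left(\sum_n(1-X_n)<+\infty\right)>0\quad\Longleftrightarrow\quad\mathbb{P}\left(\sum_{n\ge1}\prod_{k=1}^n(1-\mathbf 1_{A_k}\gamma_k)<+\infty\right)>0.$$
   Context: Let $0<p_B<p_A<1$. Let $(\gamma_n)_{n\ge1}$ be a deterministic sequence in $(0,1)$ with $\sum_{k=1}^n\gamma_k\to+\infty$. Let $(U_n)_{n\ge1}$ be i.i.d. uniform random variables on $[0,1]$, and let $(A_n)_{n\ge1}$, $(B_n)_{n\ge1}$ be events with $\mathbb{P}(A_n)=p_A$, $\mathbb{P}(B_n)=p_B$ for all $n$; the pairs $(\mathbf 1_{A_n},\mathbf 1_{B_n})_{n\ge1}$ are independent in $n$ (no assumption is made on the dependence between $A_n$ and $B_n$), and the sequence $(\mathbf 1_{A_n},\mathbf 1_{B_n})_{n\ge1}$ is independent of $(U_n)_{n\ge1}$. The two-armed bandit algorithm is defined by $X_0=x$ and $$X_{n+1}=X_n+\gamma_{n+1}\left(\mathbf 1_{\{U_{n+1}\le X_n\}\cap A_{n+1}}(1-X_n)-\mathbf 1_{\{U_{n+1}>X_n\}\cap B_{n+1}}X_n\right),\quad n\ge0.$$ The notation $\mathbb{P}_x$ refers to $X_0=x$. *)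

(* Defs.v *)
From HB Require Import structures.
From mathcomp Require Import all_boot all_order all_algebra.
From mathcomp Require Import all_classical all_reals all_analysis.
Set Implicit Arguments.
Unset Strict Implicit.
Unset Printing Implicit Defensive.
Import Order.TTheory GRing.Theory Num.Theory.
Import numFieldNormedType.Exports.
Local Open Scope classical_set_scope.
Local Open Scope ring_scope.

(* Mutual independence of a sequence of random elements: the product rule over
   every finite set of indices (a duplicate-free list). *)
Definition mutually_independent {d d' : measure_display} {T : measurableType d}
    {T' : measurableType d'} {R : realType} (P : probability T R)
    (X : nat -> T -> T') : Prop :=
  forall (s : seq nat) (E : nat -> set T'),
    uniq s -> (forall i, i \in s -> measurable (E i)) ->
    (P (\bigcap_(i in [set` s]) (X i @^-1` E i)) =
     \prod_(i <- s) P (X i @^-1` E i))%E.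

Definition sigma_of_seq {d d' : measure_display} {T : measurableType d}
    {T' : measurableType d'} (X : nat -> T -> T') : set_system T :=
  <<s \bigcup_n preimage_set_system setT (X n) measurable >>.

Definition independent_sequences {d d1 d2 : measure_display}
    {T : measurableType d} {T1 : measurableType d1} {T2 : measurableType d2}
    {R : realType} (P : probability T R)
    (X : nat -> T -> T1) (Y : nat -> T -> T2) : Prop :=
  forall E F : set T, sigma_of_seq X E -> sigma_of_seq Y F ->
    P (E `&` F) = (P E * P F)%E.

Definition indic_pair {T : Type} {R : realType} (A B : nat -> set T)
    (n : nat) (w : T) : R * R := (\1_(A n) w, \1_(B n) w).

(* The driving sequences gamma, U, A, B are indexed from 1: their terms of index 0
   are never used. *)
Fixpoint bandit {T : Type} {R : realType} (gamma : nat -> R)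
    (U : nat -> T -> R) (A B : nat -> set T) (x : R) (n : nat) : T -> R :=
  match n with
  | 0%N => fun=> x
  | n'.+1 => let Xn := bandit gamma U A B x n' in
      fun w => Xn w + gamma n'.+1 *
        (\1_([set t | U n'.+1 t <= Xn t] `&` A n'.+1) w * (1 - Xn w)
         - \1_([set t | U n'.+1 t > Xn t] `&` B n'.+1) w * Xn w)
  end.

(* Main.v *)
Require Import Defs.
From HB Require Import structures.
From mathcomp Require Import all_boot all_order all_algebra.
From mathcomp Require Import all_classical all_reals all_analysis.
From mathcomp Require Import measurable_realfun measurable_fun_approximation.
From mathcomp Require Import zify ring lra.
Set Implicit Arguments.
Unset Strict Implicit.
Unset Printing Implicit Defensive.
Import Order.TTheory GRing.Theory Num.Theory.
Import numFieldNormedType.Exports.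
Local Open Scope classical_set_scope.
Local Open Scope ring_scope.

(** Write gamma_k for the step sizes, X_n for the bandit, L_n = 1 - X_n for its
loss and D_n = prod_(1 <= k <= n) (1 - 1_(A k) gamma_k) for the discount.  The
link between the two series is that as long as no error U_{n+1} > X_n occurs,
the loss is multiplied at each step by the factor that multiplies the discount
([bandit_lossS]); the event B only acts through errors.

A finite sum of the L_n forces the sum of the D_n to be finite, almost surely.
Given the past, an error occurs at time n + 1 with probability L_n, so by a
conditional Borel-Cantelli argument only finitely many errors occur when the
sum of the losses is finite ([errors_null]).  After the last error, L_n is a
fixed positive multiple of D_n ([trusted_sub_discounted]).

Conversely, if the sum of the D_n is finite with positive probability, it is
bounded by some K with positive probability.  A path without any error has
X_n = 1 - (1 - x) D_n, a function of the events A alone; given these events, the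
probability that the path never leaves this ideal path is the product of its
values.  That product is bounded below in terms of K and x, since each factor
is at least expR (- (1 - x) / x * D_n) ([measure_follow_ge]), and on an
error-free path the sum of the losses is (1 - x) times that of the discounts
([follow_trusted]).

All conditioning is elementary: X_n is a function of finitely many binary
outcomes, so it suffices to condition on the atoms of a finite partition, and
every atom is a rectangle F `&` bigcap_(i < n) U_{i+1} @^-1` E_i with F
generated by the events A and B, to which the independence hypotheses apply
directly ([measure_rectangle], [history_rectangle]). *)

(** * Summability as a countable union of bounds *)

Lemma nneseries_lt_pinftyP (R : realType) (u : nat -> R) (m : nat) :
  (forall n, 0 <= u n) ->
  (\sum_(m <= n <oo) (u n)%:E < +oo)%E <->
  exists K : nat, forall n, \sum_(m <= k < n) u k <= K%:R.
Proof.
move=> u0; have u0E n : (0 <= (u n)%:E)%E by rewrite lee_fin.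
split=> [uoo|[K uK]].
  have ufin : (\sum_(m <= n <oo) (u n)%:E)%E \is a fin_num.
    by rewrite ge0_fin_numE// nneseries_ge0.
  exists (Num.truncn (fine (\sum_(m <= n <oo) (u n)%:E)%E)).+1 => n.
  apply: (le_trans _ (ltW (truncnS_gt _))).
  rewrite -lee_fin fineK// -sumEFin.
  exact: (@nneseries_lim_ge R (fun k => (u k)%:E) xpredT m n).
apply: (@le_lt_trans _ _ K%:R%:E); last exact: ltry.
apply: lime_le; first by apply: is_cvg_nneseries => *; exact: u0E.
by apply: nearW => n; rewrite sumEFin lee_fin.
Qed.

Section summable.
Context (T : Type) (R : realType).
Implicit Types (u : nat -> T -> R).

Definition sum_bounded m u (K : nat) : set T :=
  [set w | forall n, \sum_(m <= k < n) u k w <= K%:R].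

Lemma summable_bigcup m u : (forall n w, 0 <= u n w) ->
  [set w | (\sum_(m <= n <oo) (u n w)%:E < +oo)%E] = \bigcup_K sum_bounded m u K.
Proof.
move=> u0; apply/seteqP; split=> w /=.
  by move=> /(nneseries_lt_pinftyP m (u0 ^~ w))[K Kw]; exists K.
by move=> [K _ Kw]; apply/(nneseries_lt_pinftyP m (u0 ^~ w)); exists K.
Qed.

End summable.

Lemma measurable_le_set d (T : measurableType d) (R : realType) (f g : T -> R) :
  measurable_fun setT f -> measurable_fun setT g ->
  measurable [set w | f w <= g w].
Proof.
move=> mf mg; have := measurable_fun_ler mf mg.
by move=> /(_ measurableT [set true]); rewrite setTI; apply.
Qed.

Lemma measurable_sum_bounded d (T : measurableType d) (R : realType) m
    (u : nat -> T -> R) K : (forall n, (m <= n)%N -> measurable_fun setT (u n)) ->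
  measurable (sum_bounded m u K).
Proof.
move=> mu; rewrite (_ : sum_bounded _ _ _ =
    \bigcap_n [set w | \sum_(m <= k < n) u k w <= K%:R]); last first.
  by apply/seteqP; split=> w Kw; [move=> n _; exact: Kw|move=> n; exact: Kw].
apply: bigcap_measurableType => n _.
have mS : measurable_fun setT (fun w => \sum_(m <= k < n) u k w).
  under eq_fun do rewrite big_nat_cond big_mkcond.
  apply: measurable_sum => k.
  case: (boolP ((m <= k < n)%N && true)) => [/andP[/andP[mk _] _]|_];
    [exact: mu|exact: measurable_cst].
exact: measurable_le_set mS (measurable_cst _).
Qed.

(** * Decomposition along finite partitions *)

Section fibers.
Context d (T : measurableType d) (R : realType) (mu : {measure set T -> \bar R}).
Context (I : finType) (Z : T -> I).
Hypothesis mZ : forall i, measurable (Z @^-1` [set i]).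

Let fibers_cover : \big[setU/set0]_(i <- index_enum I) (Z @^-1` [set i]) = setT.
Proof.
rewrite -subTset => w _; rewrite -bigcup_seq.
by exists (Z w) => //=; rewrite mem_index_enum.
Qed.

Let fibers_triv (D : set I) : trivIset D (fun i => Z @^-1` [set i]).
Proof. by move=> i j _ _ [w [/= <- <-]]. Qed.

Lemma ge0_integral_fibers (f : T -> \bar R) :
  measurable_fun [set: T] f -> (forall w, 0 <= f w)%E ->
  (\int[mu]_w f w = \sum_i \int[mu]_(w in Z @^-1` [set i]) f w)%E.
Proof.
move=> mf f0; rewrite -fibers_cover ge0_integral_bigsetU//.
- exact: index_enum_uniq.
- exact: measurable_funTS.
Qed.

Lemma measure_fibers (V : set T) : measurable V ->
  (mu V = \sum_i mu (V `&` Z @^-1` [set i]))%E.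
Proof.
move=> mV; rewrite -[in LHS](setIT V) -integral_indic// ge0_integral_fibers.
- by apply: eq_bigr => i _; rewrite integral_indic.
- by apply/measurable_EFinP; exact: measurable_indic.
- by move=> w; rewrite lee_fin.
Qed.

End fibers.

(** The atoms of the partition of [T] by the first [n] terms of a sequence of
finitely valued functions are represented by their points: [prefix_class w0] is
the atom of [w0], so that statements about all atoms concern nonempty ones. *)
Section prefix_classes.
Context d (T : measurableType d) (R : realType) (mu : {measure set T -> \bar R}).
Context (L : finType) (a : nat -> T -> L) (n : nat).

Definition prefix_class (w0 : T) : set T :=
  [set w | forall k, (k < n)%N -> a k w = a k w0].

Let Z w : {ffun 'I_n -> L} := [ffun k : 'I_n => a k w].

Let fiberE w0 : Z @^-1` [set Z w0] = prefix_class w0.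
Proof.
apply/seteqP; split=> w /= Hw.
  by move=> k kn; have /ffunP/(_ (Ordinal kn)) := Hw; rewrite !ffunE.
by apply/ffunP => k; rewrite !ffunE Hw.
Qed.

Let fiber0 i : ~ (exists w0, Z w0 = i) -> Z @^-1` [set i] = set0.
Proof. by move=> nZ; rewrite -subset0 => w /= Zw; apply: nZ; exists w. Qed.

Hypothesis mC : forall w0, measurable (prefix_class w0).

Let mZ i : measurable (Z @^-1` [set i]).
Proof.
have [[w0 <-]|/fiber0 ->//] := pselect (exists w0, Z w0 = i).
by rewrite fiberE.
Qed.

Lemma measure_integral_prefix (V : set T) (f : T -> \bar R) :
  measurable V -> measurable_fun [set: T] f -> (forall w, 0 <= f w)%E ->
  (forall w0, mu (V `&` prefix_class w0) =
              \int[mu]_(w in prefix_class w0) f w)%E ->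
  (mu V = \int[mu]_w f w)%E.
Proof.
move=> mV mf f0 Vf; rewrite (ge0_integral_fibers _ mZ)// (measure_fibers _ mZ)//.
apply: eq_bigr => i _.
have [[w0 <-]|/fiber0 ->] := pselect (exists w0, Z w0 = i).
  by rewrite fiberE Vf.
by rewrite setI0 measure0 integral_set0.
Qed.

Lemma le_measure_prefix (V W : set T) (c : R) :
  measurable V -> measurable W ->
  (forall w0, c%:E * mu (V `&` prefix_class w0) <= mu (W `&` prefix_class w0))%E ->
  (c%:E * mu V <= mu W)%E.
Proof.
move=> mV mW VW; rewrite (measure_fibers _ mZ mV) (measure_fibers _ mZ mW).
rewrite ge0_sume_distrr//; apply: lee_sum => i _.
have [[w0 <-]|/fiber0 ->] := pselect (exists w0, Z w0 = i).
  by rewrite fiberE.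
by rewrite !setI0 !measure0 mule0.
Qed.

End prefix_classes.

(** * The uniform law on rays *)

Lemma uniform_prob_ray_gt (R : realType) (v : R) : 0 <= v <= 1 ->
  uniform_prob (@ltr01 R) `]v, +oo[ = (1 - v)%:E.
Proof.
move=> /andP[v0 v1]; rewrite /uniform_prob integral_uniform_pdf.
have -> : `]v, +oo[ `&` `[0, 1] = `]v, 1]%classic :> set R.
  apply/seteqP; split=> y /=; rewrite !in_itv/= ?andbT.
    by move=> [-> /andP[_ ->]].
  by move=> /andP[vy ->]; split=> //; rewrite (ltW (le_lt_trans v0 vy)).
rewrite (eq_integral (fun=> 1%:E)); last first.
  move=> y; rewrite inE/= in_itv/= => /andP[vy y1].
  by rewrite /uniform_pdf y1 (ltW (le_lt_trans v0 vy)) subr0 invr1.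
rewrite integral_cst//= mul1e lebesgue_measure_itv/= lte_fin.
case: ltP => // v1'; rewrite (_ : v = 1) ?subrr//.
by apply/eqP; rewrite eq_le v1.
Qed.

Lemma uniform_prob_ray_le (R : realType) (v : R) : 0 <= v <= 1 ->
  uniform_prob (@ltr01 R) `]-oo, v] = v%:E.
Proof.
move=> v01; rewrite -setCitvr.
apply: (eq_trans (probability_setC (uniform_prob (@ltr01 R)) _)) => //.
have /= -> := uniform_prob_ray_gt v01.
by rewrite -EFinB opprB addrC subrK.
Qed.

(** * The discount *)

Section discount.
Context (T : Type) (R : realType) (gamma : nat -> R) (A : nat -> set T).

Definition discount (n : nat) (w : T) : R :=
  \prod_(1 <= k < n.+1) (1 - \1_(A k) w * gamma k).

Lemma discount0 w : discount 0 w = 1.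
Proof. by rewrite /discount big_geq. Qed.

Lemma discountS n w :
  discount n.+1 w = discount n w * (1 - \1_(A n.+1) w * gamma n.+1).
Proof. by rewrite /discount big_nat_recr. Qed.

Hypothesis gamma01 : forall n, 0 < gamma n.+1 < 1.

Lemma discount_factor01 n w : 0 < 1 - \1_(A n.+1) w * gamma n.+1 <= 1.
Proof.
by have := gamma01 n; rewrite indicE; case: (w \in _) => /= g01; lra.
Qed.

Lemma discount01 n w : 0 < discount n w <= 1.
Proof.
elim: n => [|n /andP[p0 p1]]; first by rewrite discount0 ltr01 lexx.
rewrite discountS; have /andP[f0 f1] := discount_factor01 n w.
by rewrite mulr_gt0//= mulr_ile1// ltW.
Qed.

Lemma discount_ge0 n w : 0 <= discount n w.
Proof. by have /andP[/ltW] := discount01 n w. Qed.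

Lemma eq_discount n w w' :
  (forall k, (k < n)%N -> (w \in A k.+1) = (w' \in A k.+1)) ->
  discount n w = discount n w'.
Proof.
elim: n => [|n IHn] ww'; first by rewrite !discount0.
rewrite !discountS IHn => [|k kn]; last by apply: ww'; exact: ltnW.
by rewrite !indicE ww'.
Qed.

End discount.

Lemma measurable_discount d (T : measurableType d) (R : realType)
    (gamma : nat -> R) (A : nat -> set T) n :
  (forall k, measurable (A k.+1)) ->
  measurable_fun setT (discount gamma A n : T -> R).
Proof.
move=> mA; elim: n => [|n IHn].
  rewrite (_ : discount gamma A 0 = cst 1); first exact: measurable_cst.
  by apply/funext => w; rewrite discount0.
rewrite (_ : discount gamma A n.+1 = fun w => discount gamma A n w *
  (1 - \1_(A n.+1) w * gamma n.+1)); last first.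
  by apply/funext => w; rewrite discountS.
apply: measurable_funM => //; apply: measurable_funB => //.
by apply: measurable_funM => //; exact: measurable_indic.
Qed.

(** * Bandit paths and their losses *)

Section bandit.
Context d (T : measurableType d) (R : realType) (P : probability T R).
Variables (gamma : nat -> R) (U : nat -> T -> R) (A B : nat -> set T) (x : R).
Hypothesis gamma01 : forall n, 0 < gamma n.+1 < 1.
Hypothesis x01 : 0 < x < 1.

Local Notation X := (bandit gamma U A B x).
Local Notation AB := (fun n => indic_pair A B n.+1 : T -> R * R).
Local Notation discount := (discount gamma A).

Lemma banditS n w : X n.+1 w = X n w + gamma n.+1 *
  (if U n.+1 w <= X n w then \1_(A n.+1) w * (1 - X n w)
   else - (\1_(B n.+1) w * X n w)).
Proof.
rewrite /= !indicI /=.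
have indic_set (p : pred T) : \1_[set t | p t] w = (p w)%:R :> R.
  rewrite indicE; congr (nat_of_bool _)%:R.
  by apply/idP/idP => [/set_mem//|pw]; exact: mem_set.
rewrite (indic_set (fun t => X n t < U n.+1 t)).
rewrite (indic_set (fun t => U n.+1 t <= X n t)).
rewrite ltNge; case: (U n.+1 w <= X n w) => /=.
  by rewrite !(mul0r, mul1r) subr0.
by rewrite !(mul0r, mul1r) sub0r.
Qed.

Lemma bandit01 n w : 0 < X n w < 1.
Proof.
elim: n => [//|n /andP[X0 X1]]; rewrite banditS.
have /andP[g0 g1] := gamma01 n.
case: ifPn => _; rewrite indicE; case: (w \in _) => /=; nra.
Qed.

(** The identity behind the theorem: without an error, the loss and the discount
are multiplied by the same factor. *)
Lemma bandit_lossS n w : U n.+1 w <= X n w ->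
  1 - X n.+1 w = (1 - X n w) * (1 - \1_(A n.+1) w * gamma n.+1).
Proof. by rewrite banditS => ->; ring. Qed.

Lemma bandit_loss_from N w : (forall n, (N <= n)%N -> U n.+1 w <= X n w) ->
  forall n, (N <= n)%N ->
    1 - X n w = (1 - X N w) / discount N w * discount n w.
Proof.
move=> good n; elim: n => [|n IHn].
  rewrite leqn0 => /eqP ->; rewrite divfK//.
  by rewrite gt_eqF//; have /andP[] := discount01 A gamma01 0 w.
rewrite leq_eqVlt => /predU1P[<-|]; last first.
  rewrite ltnS => Nn; rewrite bandit_lossS ?good//.
  by rewrite IHn// discountS mulrA.
by rewrite divfK// gt_eqF//; have /andP[] := discount01 A gamma01 N w.
Qed.

(** The binary outcomes that lead from [X n] to [X n.+1]: since the step sizes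
are deterministic, the first [n] letters determine [X n]. *)
Definition letter (n : nat) (w : T) : bool * bool * bool :=
  (U n.+1 w <= X n w, w \in A n.+1, w \in B n.+1).

Lemma bandit_letters n w w' : (forall k, (k < n)%N -> letter k w = letter k w') ->
  X n w = X n w'.
Proof.
elim: n => // n IHn ww'; rewrite !banditS IHn; last first.
  by move=> k kn; apply: ww'; rewrite (ltn_trans kn).
have := ww' n (ltnSn n); rewrite /letter => -[].
rewrite IHn; last by move=> k kn; apply: ww'; rewrite (ltn_trans kn).
by move=> -> AE BE; rewrite !indicE AE BE.
Qed.

(** * Independence on rectangles *)

Hypothesis mU : forall n, measurable_fun setT (U n.+1).
Hypothesis U_unif : forall n (E : set R), measurable E ->
  P (U n.+1 @^-1` E) = uniform_prob (@ltr01 R) E.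
Hypothesis U_indep : mutually_independent P (fun n => U n.+1).
Hypothesis mA : forall n, measurable (A n.+1).
Hypothesis mB : forall n, measurable (B n.+1).
Hypothesis AB_U_indep : independent_sequences P AB (fun n => U n.+1).

Lemma measurable_bandit n : measurable_fun setT (X n).
Proof.
elim: n => [|n IHn]; first exact: measurable_cst.
rewrite (_ : X n.+1 = fun w => X n w + gamma n.+1 *
  (if U n.+1 w <= X n w then \1_(A n.+1) w * (1 - X n w)
   else - (\1_(B n.+1) w * X n w))); last first.
  by apply/funext => w; exact: banditS.
apply: measurable_funD => //; apply: measurable_funM => //.
apply: measurable_fun_ifT.
- exact: measurable_fun_ler.
- apply: measurable_funM; first exact: measurable_indic.
  exact: measurable_funB.
- apply: measurableT_comp => //; exact: measurable_funM.
Qed.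

Local Notation GAB :=
  (\bigcup_n preimage_set_system setT (AB n) (@measurable _ (R * R)%type)).

Lemma sigma_AB_A n : sigma_of_seq AB (A n.+1).
Proof.
apply: sub_sigma_algebra; exists n => //.
exists (fst @^-1` [set 1]).
  rewrite -[X in measurable X]setTI.
  have := @measurable_fst _ _ R R measurableT [set 1] (measurable_set1 1); exact.
rewrite setTI; apply/seteqP; split=> w /=; rewrite indicE.
  by case: (boolP (w \in A n.+1)) => [/set_mem//|_ /eqP]; rewrite eq_sym oner_eq0.
by move=> Aw; rewrite mem_set.
Qed.

Lemma sigma_AB_B n : sigma_of_seq AB (B n.+1).
Proof.
apply: sub_sigma_algebra; exists n => //.
exists (snd @^-1` [set 1]).
  rewrite -[X in measurable X]setTI.
  have := @measurable_snd _ _ R R measurableT [set 1] (measurable_set1 1); exact.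
rewrite setTI; apply/seteqP; split=> w /=; rewrite indicE.
  by case: (boolP (w \in B n.+1)) => [/set_mem//|_ /eqP]; rewrite eq_sym oner_eq0.
by move=> Aw; rewrite mem_set.
Qed.

Lemma measurable_sigma_AB F : sigma_of_seq AB F -> measurable F.
Proof.
apply: smallest_sub; first exact: sigma_algebra_measurable.
move=> _ [n _ [E mE <-]].
have mAB : measurable_fun setT (AB n).
  by apply/measurable_fun_pairP; split; exact: measurable_indic.
exact: mAB.
Qed.

(** [F] may depend on all the events [A] and [B]: for [measure_follow_ge] it has to
contain the bound on the whole series of discounts. *)
Lemma measure_rectangle n (F : set T) (E : nat -> set R) :
  sigma_of_seq AB F -> (forall i, measurable (E i)) ->
  (P (F `&` \bigcap_(i < n) U i.+1 @^-1` E i) =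
   P F * \prod_(0 <= i < n) uniform_prob (@ltr01 R) (E i))%E.
Proof.
move=> sF mE.
have sU : sigma_of_seq (fun n => U n.+1) (\bigcap_(i < n) U i.+1 @^-1` E i).
  pose G := \bigcup_n preimage_set_system setT (U n.+1)
    (@measurable _ (R : measurableType _)).
  suff : @measurable _ (g_sigma_algebraType G)
    (\bigcap_(i < n) U i.+1 @^-1` E i) by [].
  apply: bigcap_measurableType => i _; apply: sub_sigma_algebra.
  by exists i => //; exists (E i) => //; rewrite setTI.
rewrite (AB_U_indep sF sU); congr (_ * _)%E.
have -> : `I_n = [set` index_iota 0 n].
  by apply/seteqP; split=> i /=; rewrite mem_index_iota.
rewrite (U_indep (iota_uniq _ _)); last by move=> i _; exact: mE.
by apply: eq_bigr => i _; exact: U_unif.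
Qed.

Lemma sigma_AB_mem (C : set T) b :
  sigma_of_seq AB C -> sigma_of_seq AB [set w | (w \in C) = b].
Proof.
move=> sC; case: b.
  rewrite (_ : [set w | _] = C)//.
  by apply/seteqP; split=> w /=; [move/set_mem | move/mem_set].
rewrite (_ : [set w | _] = ~` C); first exact: sigma_algebraC.
by apply/seteqP; split=> w /=; [move/negbT/negP; rewrite in_setE
  | move=> nC; exact: memNset].
Qed.

(** * Errors given the past *)

Local Notation history := (prefix_class letter).

(** On the atom of [w0], the thresholds [X i] are constant, equal to [X i w0], so
that the outcomes of the comparisons [U i.+1 <= X i] constrain each uniform
variable separately. *)
Lemma history_rectangle n w0 : exists (F : set T) (E : nat -> set R),
  [/\ sigma_of_seq AB F, forall i, measurable (E i) &
      history n w0 = F `&` \bigcap_(i < n) U i.+1 @^-1` E i].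
Proof.
exists (\bigcap_(i < n) ([set w | (w \in A i.+1) = (w0 \in A i.+1)] `&`
                    [set w | (w \in B i.+1) = (w0 \in B i.+1)])).
exists (fun i => [set v | (v <= X i w0) = (U i.+1 w0 <= X i w0)]); split.
- suff : @measurable _ (g_sigma_algebraType GAB) (\bigcap_(i < n)
    ([set w | (w \in A i.+1) = (w0 \in A i.+1)] `&`
     [set w | (w \in B i.+1) = (w0 \in B i.+1)])) by [].
  apply: bigcap_measurableType => i _; apply: measurableI.
    exact: (sigma_AB_mem _ (sigma_AB_A _)).
  exact: (sigma_AB_mem _ (sigma_AB_B _)).
- move=> i; case: (U i.+1 w0 <= X i w0).
    have -> : [set v | (v <= X i w0) = true] = `]-oo, X i w0]%classic.
      by apply/seteqP; split=> v /=; rewrite in_itv.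
    exact: measurable_itv.
  have -> : [set v | (v <= X i w0) = false] = `]X i w0, +oo[%classic.
    apply/seteqP; split=> v /=; rewrite in_itv/= andbT ltNge.
      by move=> ->.
    by move/negbTE.
  exact: measurable_itv.
- apply/seteqP; split=> [w Hw|w [Fw Ew] k].
    split=> k /= kn; have := Hw k kn; rewrite /letter => -[Uk Ak Bk] //.
    rewrite -Uk (bandit_letters (w' := w0))// => j jk; apply: Hw.
    exact: ltn_trans kn.
  elim/ltn_ind: k => k IHk kn; have [/= FA FB] := Fw k kn.
  rewrite /letter FA FB; have /= <- := Ew k kn.
  rewrite (bandit_letters (w' := w0))// => j jk; apply: IHk => //.
  exact: ltn_trans kn.
Qed.

Lemma measurable_history n w0 : measurable (history n w0).
Proof.
have [F [E [sF mE ->]]] := history_rectangle n w0.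
apply: measurableI; first exact: measurable_sigma_AB.
apply: bigcap_measurableType => i _.
by rewrite -[X in measurable X]setTI; exact: mU.
Qed.

Definition error (n : nat) : set T := [set w | X n w < U n.+1 w].

Lemma measurable_error n : measurable (error n).
Proof.
have := measurable_fun_ltr (measurable_bandit n) (mU n).
by move=> /(_ measurableT [set true]); rewrite setTI; apply.
Qed.

(** The conditional probability of an error given the past is the current loss:
the event adds to the rectangle of the past one side that constrains a new
uniform variable. *)
Lemma measure_history_error n w0 :
  (P (history n w0 `&` error n) =
   (1 - X n w0)%:E * P (history n w0))%E.
Proof.
have [F [E [sF mE HE]]] := history_rectangle n w0.
pose E' i := if (i < n)%N then E i else `]X n w0, +oo[%classic.
have -> : history n w0 `&` error n =
    F `&` \bigcap_(i < n.+1) U i.+1 @^-1` E' i.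
  apply/seteqP; split=> [w [Hw /= Xw]|w [Fw Ew]].
    have [Fw Ew] : (F `&` \bigcap_(i < n) U i.+1 @^-1` E i) w by rewrite -HE.
    split=> // i /=; rewrite ltnS leq_eqVlt /E' => /predU1P[->|iltn].
      by rewrite ltnn /= in_itv/= andbT -(bandit_letters (w := w)).
    by rewrite iltn; exact: Ew.
  have Hw : history n w0 w.
    rewrite HE; split=> // i /= iltn.
    by have := Ew i (ltnW iltn); rewrite /= /E' iltn.
  split=> //=; have := Ew n (ltnSn n).
  by rewrite /error /= /E' ltnn/= in_itv/= andbT (bandit_letters Hw).
rewrite measure_rectangle//; last by move=> i; rewrite /E'; case: ifP.
rewrite HE measure_rectangle// big_nat_recr//= {2}/E' ltnn.
rewrite uniform_prob_ray_gt; last first.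
  by have /andP[? ?] := bandit01 n w0; rewrite !ltW.
rewrite [RHS]muleC muleA; congr (_ * _ * _)%E.
by apply: eq_big_nat => i /andP[_ iltn]; rewrite /E' iltn.
Qed.

(** Summing over the atoms of the past.  The hypothesis on [G] says that it is a
union of such atoms. *)
Lemma measure_error n (G : set T) : measurable G ->
  (forall w w', history n w w' -> G w -> G w') ->
  (P (G `&` error n) =
   \int[P]_w ((1 - X n w) * \1_G w)%:E)%E.
Proof.
move=> mG GH.
apply: (measure_integral_prefix (measurable_history n)).
- by apply: measurableI => //; exact: measurable_error.
- apply/measurable_EFinP; apply: measurable_funM => //.
  by apply: measurable_funB => //; exact: measurable_bandit.
- move=> w; rewrite lee_fin mulr_ge0// subr_ge0.
  by have /andP[_ /ltW] := bandit01 n w.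
move=> w0; rewrite (eq_integral (fun=> ((1 - X n w0) * \1_G w0)%:E)); last first.
  move=> w /set_mem Hw; rewrite (bandit_letters Hw) !indicE.
  congr (_ * (nat_of_bool _)%:R)%:E; apply/idP/idP => /set_mem Gw.
    by apply/mem_set/(GH w) => // k kn; rewrite Hw.
  by apply/mem_set/(GH w0).
rewrite integral_cst//; last exact: measurable_history.
have [Gw0|nGw0] := pselect (G w0).
  rewrite indicE mem_set// mulr1 -measure_history_error; congr (P _).
  apply/seteqP; split=> [w [[_ ew] Hw]//|w [Hw ew]]; split=> //; split=> //.
  apply: (GH w0) => // k kn; exact: Hw.
rewrite indicE memNset// mulr0 mul0e (_ : _ `&` _ = set0) ?measure0//.
rewrite -subset0 => w [[Gw _] Hw]; apply: nGw0; apply: (GH w) => // k kn.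
by rewrite Hw.
Qed.

(** * Finite total loss leaves finitely many errors *)

Lemma bandit_loss_ge0 n w : 0 <= 1 - X n w.
Proof. by rewrite subr_ge0; have /andP[_ /ltW] := bandit01 n w. Qed.

Lemma measurable_bandit_loss n : measurable_fun setT (fun w => 1 - X n w).
Proof. by apply: measurable_funB => //; exact: measurable_bandit. Qed.

(** Truncating at the time [n] itself, and not over the whole path, keeps the
event in the past of the next uniform variable. *)
Definition small_loss (K n : nat) : set T :=
  [set w | \sum_(0 <= k < n.+1) (1 - X k w) <= K%:R].

Lemma measurable_small_loss K n : measurable (small_loss K n).
Proof.
have mS : measurable_fun setT (fun w => \sum_(0 <= k < n.+1) (1 - X k w)).
  by apply: measurable_sum => k; exact: measurable_bandit_loss.
exact: measurable_le_set mS (measurable_cst _).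
Qed.

Lemma small_loss_history K n w w' :
  history n w w' -> small_loss K n w -> small_loss K n w'.
Proof.
move=> Hw; suff XE : \sum_(0 <= k < n.+1) (1 - X k w') =
    \sum_(0 <= k < n.+1) (1 - X k w) by rewrite /small_loss /= XE.
apply: eq_big_nat => k; rewrite ltnS => /andP[_ kn]; congr (1 - _).
by apply: bandit_letters => j jk; apply: Hw; exact: leq_trans kn.
Qed.

(** Up to the last time at which the cumulated loss is small, the sum is at most
that cumulated loss; later terms vanish. *)
Lemma sum_small_loss K m w :
  \sum_(0 <= n < m) (1 - X n w) * \1_(small_loss K n) w <= K%:R.
Proof.
elim: m => [|m IHm]; first by rewrite big_geq.
have [Sm|nSm] := pselect (small_loss K m w); last first.
  by rewrite big_nat_recr//= indicE memNset// mulr0 addr0.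
apply: le_trans Sm; apply: ler_sum_nat => n _.
by rewrite indicE; case: (w \in _); rewrite ?mulr1 ?mulr0 ?bandit_loss_ge0.
Qed.

(** The first Borel-Cantelli lemma: by [measure_error], the probabilities add up to
the expectation of a sum that [sum_small_loss] bounds by [K]. *)
Lemma errors_null K :
  P (lim_sup_set (fun n => small_loss K n `&` error n)) = 0%E.
Proof.
have mSL n : measurable (small_loss K n) by exact: measurable_small_loss.
apply: lim_sup_set_cvg0.
  by move=> n; apply: measurableI => //; exact: measurable_error.
apply: (@le_lt_trans _ _ K%:R%:E); last exact: ltry.
apply: lime_le.
  by apply: is_cvg_nneseries => n _ _; exact: measure_ge0.
apply: nearW => m.
rewrite (eq_bigr (fun n =>
    (\int[P]_w ((1 - X n w) * \1_(small_loss K n) w)%:E)%E)); last first.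
  by move=> n _; exact: (measure_error (mSL n) (@small_loss_history K n)).
rewrite -ge0_integral_sum//; last 2 first.
- move=> n; apply/measurable_EFinP; apply: measurable_funM => //.
  exact: measurable_bandit_loss.
- by move=> n w _; rewrite lee_fin mulr_ge0// bandit_loss_ge0.
under eq_integral do rewrite sumEFin.
apply: (@le_trans _ _ (\int[P]_w (cst K%:R%:E w))%E).
  apply: ge0_le_integral => //.
  - move=> w _; rewrite lee_fin sumr_ge0// => n _.
    by rewrite mulr_ge0// bandit_loss_ge0.
  - apply/measurable_EFinP; apply: measurable_sum => n.
    apply: measurable_funM => //; exact: measurable_bandit_loss.
  - by move=> w _; rewrite lee_fin sum_small_loss.
by rewrite integral_cst//= probability_setT mule1.
Qed.

Local Notation trusted := (\bigcup_K sum_bounded 0 (fun n w => 1 - X n w) K).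
Local Notation discounted := (\bigcup_K sum_bounded 1 (fun n w => discount n w) K).

(** After the last error, at some time [N], the loss is [c] times the discount with
[c > 0]; the discounts before [N] are at most [1] each. *)
Lemma trusted_sub_discounted : trusted `<=`
  discounted `|` \bigcup_K lim_sup_set (fun n => small_loss K n `&` error n).
Proof.
move=> w [K _ Kw].
have [inf|] := pselect (lim_sup_set (fun n => small_loss K n `&` error n) w).
  by right; exists K.
move=> /existsNP[N] /not_implyP[_ noerr]; left.
have good n : (N <= n)%N -> U n.+1 w <= X n w.
  move=> Nn; rewrite leNgt; apply/negP => err; apply: noerr.
  by exists n => //; split=> //; exact: Kw.
set c := (1 - X N w) / discount N w.
have c0 : 0 < c.
  rewrite divr_gt0//; first by rewrite subr_gt0; have /andP[] := bandit01 N w.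
  by have /andP[] := discount01 A gamma01 N w.
(* N bounds the discounts before N, and c^-1 * K the later ones. *)
exists (N + (Num.truncn (c^-1 * K%:R)).+1)%N => // n.
apply: (@le_trans _ _ (\sum_(0 <= k < n) discount k w)).
  case: n => [|n]; first by rewrite !big_geq.
  by rewrite [leRHS]big_ltn// lerDr discount_ge0//.
have discount_le k : discount k w <=
    (if (k < N)%N then 1 else 0) + c^-1 * (1 - X k w).
  case: ltnP => [_|Nk].
    rewrite -[leLHS]addr0 lerD//; first by have /andP[] := discount01 A gamma01 k w.
    by rewrite mulr_ge0 ?invr_ge0 ?bandit_loss_ge0// ltW.
  by rewrite (bandit_loss_from good Nk) -/c mulKf ?gt_eqF// add0r.
apply: (le_trans (ler_sum _ (fun k _ => discount_le k))).
rewrite big_split/= -mulr_sumr natrD lerD//; last first.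
  apply: (le_trans _ (ltW (truncnS_gt _))).
  by rewrite ler_pM2l ?invr_gt0//; exact: Kw.
suff -> : \sum_(0 <= k < n) (if (k < N)%N then 1 else 0) = (minn n N)%:R :> R.
  by rewrite ler_nat geq_minr.
elim: n => [|n IHn]; first by rewrite big_geq// min0n.
rewrite big_nat_recr//= IHn; case: ltnP => Nn.
  by rewrite natr1; congr (_%:R); lia.
by rewrite addr0; congr (_%:R); lia.
Qed.

Lemma trusted_le_discounted : (P trusted <= P discounted)%E.
Proof.
have mt : measurable trusted.
  by apply: bigcupT_measurable => K; apply: measurable_sum_bounded => n _;
    exact: measurable_bandit_loss.
have md : measurable discounted.
  by apply: bigcupT_measurable => K; apply: measurable_sum_bounded => n _;
    exact/measurable_discount.
have mE K : measurable (lim_sup_set (fun n => small_loss K n `&` error n)).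
  apply: bigcap_measurableType => n _; apply: bigcup_measurable => k _.
  by apply: measurableI; [exact: measurable_small_loss|exact: measurable_error].
have mEs := bigcupT_measurable _ mE.
apply: (@le_trans _ _ (P (discounted `|`
    \bigcup_K lim_sup_set (fun n => small_loss K n `&` error n)))).
  apply: le_measure; rewrite ?inE//; first exact: measurableU.
  exact: trusted_sub_discounted.
apply: (le_trans (measureU2 _ _ _)) => //.
have : P.-negligible
    (\bigcup_K lim_sup_set (fun n => small_loss K n `&` error n)).
  by apply: negligible_bigcup => K; apply/negligibleP => //; exact: errors_null.
by move=> /(negligibleP _ mEs) ->; rewrite adde0.
Qed.

(** * Following the error-free path *)

(** The value at time [n] of the path that makes no error; it depends on the
events [A] only. *)
Let ideal n w : R := 1 - (1 - x) * discount n w.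

Lemma ideal01 n w : 0 <= ideal n w <= 1.
Proof.
have /andP[d0 d1] := discount01 A gamma01 n w; have /andP[x0 x1] := x01.
by rewrite /ideal; nra.
Qed.

(** With a = (1 - x) / x * discount, the bound is expR (- a) <= (1 + a)^-1 followed
by 1 <= (1 + a) * ideal, whose two sides differ by
(1 - x)^2 / x * discount * (1 - discount). *)
Lemma expR_le_ideal n w : expR (- ((1 - x) / x * discount n w)) <= ideal n w.
Proof.
have /andP[d0 d1] := discount01 A gamma01 n w; have /andP[x0 x1] := x01.
have c0 : 0 < (1 - x) / x by rewrite divr_gt0// subr_gt0.
have := expR_ge1Dx ((1 - x) / x * discount n w) => expD.
have e0 := expR_gt0 ((1 - x) / x * discount n w).
rewrite expRN invf_ple ?posrE//; last by rewrite /ideal; nra.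
apply: le_trans expD; rewrite invf_ple ?posrE; last 2 first.
- by rewrite /ideal; nra.
- by rewrite ltr_wpDr// mulr_ge0// ltW.
rewrite -div1r ler_pdivrMr; last by rewrite ltr_wpDr// mulr_ge0// ltW.
rewrite /ideal -subr_ge0.
rewrite (_ : _ - _ = (1 - x) ^+ 2 / x * (discount n w * (1 - discount n w))).
  by rewrite !mulr_ge0 ?sqr_ge0 ?subr_ge0 ?invr_ge0// ltW.
by field; rewrite gt_eqF.
Qed.

(** [K.+1], because [sum_bounded 1] leaves out the discount of index [0], which is
[1]. *)
Definition follow_bound (K : nat) : R := expR (- ((1 - x) / x * K.+1%:R)).

Lemma prod_ideal_ge K m w : sum_bounded 1 discount K w ->
  follow_bound K <= \prod_(0 <= i < m) ideal i w.
Proof.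
move=> Kw; apply: (@le_trans _ _
    (\prod_(0 <= i < m) expR (- ((1 - x) / x * discount i w)))).
  rewrite -expR_sum ler_expR sumrN lerN2 -mulr_sumr ler_wpM2l//.
    by rewrite divr_ge0// ?subr_ge0 ltW//; have /andP[] := x01.
  case: m => [|m]; first by rewrite big_geq.
  by rewrite big_ltn// discount0 -natr1 addrC lerD2r; exact: Kw.
by apply: ler_prod => i _; rewrite expR_ge0/= expR_le_ideal.
Qed.

Lemma sigma_AB_sum_bounded K : sigma_of_seq AB (sum_bounded 1 discount K).
Proof.
have : @measurable _ (g_sigma_algebraType GAB) (sum_bounded 1 discount K).
  apply: measurable_sum_bounded => n _.
  by apply: measurable_discount => k; exact: sigma_AB_A.
exact.
Qed.

Definition follow (K m : nat) : set T := sum_bounded 1 discount K `&`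
  [set w | forall i, (i < m)%N -> U i.+1 w <= ideal i w].

Lemma measurable_follow K m : measurable (follow K m).
Proof.
apply: measurableI.
  exact: measurable_sigma_AB (sigma_AB_sum_bounded K).
rewrite (_ : [set w | _] = \bigcap_(i < m) [set w | U i.+1 w <= ideal i w])//.
apply: bigcap_measurableType => i _.
have mI : measurable_fun setT (ideal i).
  apply: measurable_funB => //; apply: measurable_funM => //.
  exact: measurable_discount.
exact: measurable_le_set.
Qed.

(** Given the events [A], the path follows the error-free one for [m] steps with
probability prod_(i < m) ideal i, which [prod_ideal_ge] bounds below uniformly
in [m]. The conditioning is on the atoms of [A 1, ..., A m]; the event
[sum_bounded 1 discount K] depends on all the [A k], but belongs to the sigma
algebra that is independent of the uniform variables. *)
Lemma measure_follow_ge K m :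
  ((follow_bound K)%:E * P (sum_bounded 1 discount K) <= P (follow K m))%E.
Proof.
pose C := prefix_class (fun k w => w \in A k.+1) m.
have sC w0 : sigma_of_seq AB (C w0).
  have : @measurable _ (g_sigma_algebraType GAB) (C w0).
    rewrite (_ : C w0 = \bigcap_(k < m)
      [set w | (w \in A k.+1) = (w0 \in A k.+1)])//.
    apply: bigcap_measurableType => k _.
    exact: (sigma_AB_mem _ (sigma_AB_A _)).
  exact.
have sS := sigma_AB_sum_bounded K.
apply: (le_measure_prefix (fun w => measurable_sigma_AB (sC w))).
- exact: measurable_sigma_AB.
- exact: measurable_follow.
move=> w1; rewrite -/(C w1).
have [->|/set0P[w0 [Sw0 Cw0]]] := eqVneq (sum_bounded 1 discount K `&` C w1) set0.
  by rewrite measure0 mule0.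
pose E k : set R := `]-oo, ideal k w0]%classic.
have -> : follow K m `&` C w1 =
    (sum_bounded 1 discount K `&` C w1) `&`
    \bigcap_(k < m) U k.+1 @^-1` E k.
  have ideal_eq w k : (C w1) w -> (k < m)%N ->
      ideal k w = ideal k w0.
    move=> Zw km; rewrite /ideal (eq_discount gamma (w' := w0))// => j jk.
    by rewrite Zw ?Cw0//; exact: ltn_trans km.
  apply/seteqP; split=> [w [[Sw Uw] Zw]|w [[Sw Zw] Uw]].
    split=> // k /= km; rewrite /E /= in_itv/= -(ideal_eq w)//; exact: Uw.
  split=> //; split=> // k km; rewrite (ideal_eq w)//.
  by have := Uw k km; rewrite /E /= in_itv.
have sSC : sigma_of_seq AB (sum_bounded 1 discount K `&` C w1).
  by apply: (@measurableI _ (g_sigma_algebraType GAB)); [exact: sS|exact: sC].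
have mE k : measurable (E k) by exact: measurable_itv.
rewrite [leRHS](measure_rectangle m sSC mE).
rewrite [leRHS]muleC; apply: lee_wpmul2r => //.
under eq_bigr do rewrite /E uniform_prob_ray_le ?ideal01//.
by rewrite prodEFin lee_fin prod_ideal_ge.
Qed.

Lemma follow_trusted K : \bigcap_m follow K m `<=` trusted.
Proof.
move=> w Fw; exists K.+1 => // n.
have [Sw _] := Fw 0 I.
have XE k : X k w = ideal k w.
  elim: k => [|k IHk].
    by rewrite /ideal discount0 mulr1 opprB addrC subrK.
  have [_ /(_ k (ltnSn k)) Uk] := Fw k.+1 I.
  rewrite -[LHS](subKr 1) bandit_lossS ?IHk//.
  by rewrite /ideal discountS; ring.
have loss k : 1 - X k w = (1 - x) * discount k w.
  by rewrite XE /ideal opprB addrC subrK.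
under eq_bigr do rewrite loss.
have /andP[x0 x1] := x01.
rewrite -mulr_sumr; apply: (@le_trans _ _ (\sum_(0 <= k < n) discount k w)).
  rewrite ler_piMl ?gerBl ?(ltW x0)// sumr_ge0// => k _.
  exact: discount_ge0.
case: n => [|n]; first by rewrite big_geq.
by rewrite big_ltn// discount0 -natr1 addrC lerD2r; exact: Sw.
Qed.

(** Letting [m] go to infinity in [measure_follow_ge], by continuity from above. *)
Lemma discounted_trusted_gt0 : (0 < P discounted)%E -> (0 < P trusted)%E.
Proof.
have mS K : measurable (sum_bounded 1 discount K).
  exact: measurable_sigma_AB (sigma_AB_sum_bounded K).
move=> d0; have [K K0] : exists K, (0 < P (sum_bounded 1 discount K))%E.
  apply: contrapT => /forallNP nK; move: d0; rewrite lt0e => /andP[/eqP + _].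
  apply; apply/negligibleP; first exact: bigcupT_measurable.
  apply: negligible_bigcup => K; apply/negligibleP => //.
  by apply/eqP; rewrite eq_le measure_ge0 andbT leNgt; apply/negP/nK.
have mF : measurable (\bigcap_m follow K m).
  by apply: bigcap_measurableType => m _; exact: measurable_follow.
apply: (@lt_le_trans _ _ (P (\bigcap_m follow K m))); last first.
  apply: le_measure; rewrite ?inE//; last exact: follow_trusted.
  by apply: bigcupT_measurable => K'; apply: measurable_sum_bounded => n _;
    exact: measurable_bandit_loss.
apply: (@lt_le_trans _ _ ((follow_bound K)%:E * P (sum_bounded 1 discount K)))%E.
  by rewrite mule_gt0// lte_fin expR_gt0.
have cF : P (follow K m) @[m --> \oo] --> P (\bigcap_m follow K m).
  apply: nonincreasing_cvg_mu => //.
  - by rewrite (le_lt_trans (probability_le1 _ _)) ?ltry//; exact: measurable_follow.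
  - by move=> m; exact: measurable_follow.
  - move=> m n mn; apply/subsetPset => w [Sw Uw]; split=> // i im.
    by apply: Uw; exact: leq_trans mn.
rewrite -(cvg_lim _ cF)//; apply: lime_ge; first by apply/cvg_ex; eexists; exact: cF.
by apply: nearW => m; exact: measure_follow_ge.
Qed.

End bandit.

(** * The equivalence *)

Theorem proposition6 (d : measure_display) (T : measurableType d) (R : realType)
    (P : probability T R)
    (pA pB : R) (hpB : 0 < pB) (hpBA : pB < pA) (hpA : pA < 1)
    (gamma : nat -> R)
    (hgamma : forall n : nat, 0 < gamma n.+1 < 1)
    (hgamma_sum : \sum_(1 <= k < n.+1) gamma k @[n --> \oo] --> +oo)
    (U : nat -> {RV P >-> R})
    (hU_unif : forall (n : nat) (E : set R), measurable E ->
       distribution P (U n.+1) E = uniform_prob (@ltr01 R) E)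
    (hU_indep : mutually_independent P (fun n : nat => U n.+1 : T -> R))
    (A B : nat -> set T)
    (mA : forall n : nat, measurable (A n.+1))
    (mB : forall n : nat, measurable (B n.+1))
    (hA : forall n : nat, P (A n.+1) = pA%:E)
    (hB : forall n : nat, P (B n.+1) = pB%:E)
    (hAB_indep : mutually_independent P
       (fun n : nat => indic_pair A B n.+1 : T -> R * R))
    (hABU_indep : independent_sequences P
       (fun n : nat => indic_pair A B n.+1 : T -> R * R)
       (fun n : nat => U n.+1 : T -> R))
    (x : R) (hx : 0 < x < 1) :
  (0 < P [set w | (\sum_(0 <= n <oo) (1 - bandit gamma (fun n => U n) A B x n w)%:E
                  < +oo)%E])%E <->
  (0 < P [set w | (\sum_(1 <= n <oo)
                     (\prod_(1 <= k < n.+1) (1 - \1_(A k) w * gamma k))%:E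
                  < +oo)%E])%E.
Proof.
have mU n : measurable_fun setT (U n.+1) by [].
rewrite (summable_bigcup 0 (bandit_loss_ge0 (fun n => U n) A B hgamma hx)).
rewrite (summable_bigcup 1 (discount_ge0 A hgamma)).
split; last first.
  exact: (discounted_trusted_gt0 hgamma hx mU hU_unif hU_indep mA mB hABU_indep).
move=> /lt_le_trans; apply.
exact: (trusted_le_discounted hgamma hx mU hU_unif hU_indep mA mB hABU_indep).
Qed.
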